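(* For any positive concave function $f:[0,\infty)\to\mathbb{R}$, there exist $N\in\mathbb{N}=\{1,2,\dots\}$ and a physical linear graph $(\mathbb{N}_0,w)$ satisfying $\mathrm{CD}(0,\infty)$ such that $w(n,n+1)=f(n+N)$ for all $n\in\mathbb{N}_0$.
   Context: A weighted graph $G=(V,E,w,m)$ is a connected, undirected, simple, locally finite graph $(V,E)$ with vertex weights $m:V\to(0,\infty)$ and symmetric edge weights $w:E\to(0,\infty)$, $w(x,y)=w(y,x)$ (with $w(x,y)=0$ if $x\not\sim y$). It is physical if $m\equiv 1$. A linear graph on $\mathbb{N}_0=\{0,1,2,\dots\}$ has vertex set $V=\mathbb{N}_0$ and edge set $E=\{\{n,n+1\}: n\in\mathbb{N}_0\}$. The Laplacian is $\Delta f(x)=\frac1{m(x)}\sum_{y\sim x}w(x,y)(f(y)-f(x))$ for $f:V\to\mathbb{R}$. Set $\Gamma(f,g)=\frac12(\Delta(fg)-f\Delta g-g\Delta f)$, $\Gamma(f)=\Gamma(f,f)$, and $\Gamma_2(f)=\frac12\Delta\Gamma(f)-\Gamma(f,\Delta f)$. For $K\in\mathbb{R}$, $D\in(0,\infty]$ (with $1/\infty=0$) and $x\in V$, the condition $\mathrm{CD}(K,D,x)$ means $\Gamma_2(f)(x)\ge\frac1D(\Delta f(x))^2+K\,\Gamma(f)(x)$ for all $f:V\to\mathbb{R}$; $\mathrm{CD}(K,D)$ means that $\mathrm{CD}(K,D,x)$ holds for all $x\in V$. *)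

(* Defs.v *)
From HB Require Import structures.
From mathcomp Require Import all_boot all_order all_algebra.
From mathcomp Require Import all_classical all_reals all_analysis.

Set Implicit Arguments.
Unset Strict Implicit.
Unset Printing Implicit Defensive.

Import Order.TTheory GRing.Theory Num.Theory.
Import numFieldNormedType.Exports.

Local Open Scope classical_set_scope.
Local Open Scope ring_scope.

(* Edge weights are a total function on pairs of vertices, which is positive
   exactly on the edges and vanishes elsewhere. *)
Record weighted_graph (R : realType) (V : choiceType) := WeightedGraph {
  adj : rel V;
  weight : V -> V -> R;
  vmass : V -> R;
  adj_sym : symmetric adj;
  adj_irrefl : irreflexive adj;
  adj_connected : forall x y, exists2 p : seq V, path adj x p & last x p = y;
  adj_locally_finite : forall x, finite_set [set y | adj x y];
  weight_sym : forall x y, weight x y = weight y x;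
  weight_gt0 : forall x y, adj x y -> 0 < weight x y;
  weight_eq0 : forall x y, ~~ adj x y -> weight x y = 0;
  vmass_gt0 : forall x, 0 < vmass x }.

Section BakryEmery.
Variables (R : realType) (V : choiceType) (G : weighted_graph R V).
Implicit Types (f g : V -> R) (x : V).

Definition physical : Prop := forall x, vmass G x = 1.

Definition laplacian f : V -> R := fun x =>
  (vmass G x)^-1 * \sum_(y \in [set y | adj G x y]) (weight G x y * (f y - f x)).

Definition Gamma f g : V -> R := fun x =>
  2^-1 * (laplacian (fun y => f y * g y) x
          - f x * laplacian g x - g x * laplacian f x).

Definition Gamma2 f : V -> R := fun x =>
  2^-1 * laplacian (Gamma f f) x - Gamma f (laplacian f) x.

(* The dimension D is meant to range over ]0, +oo]. The extended inverse
   satisfies +oo^-1 = 0, so fine D^-1 is 1/D with the convention 1/oo = 0. *)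
Definition CD_at (K : R) (D : \bar R) (x : V) : Prop :=
  forall f, Gamma2 f x >= fine (D^-1)%E * laplacian f x ^+ 2 + K * Gamma f f x.

Definition CD (K : R) (D : \bar R) : Prop := forall x, CD_at K D x.

End BakryEmery.

Definition linear_graph (R : realType) (G : weighted_graph R nat) : Prop :=
  forall m n : nat, adj G m n = (n == m.+1) || (m == n.+1).

Definition concave_function (R : realType) (A : set R) (f : R -> R) : Prop :=
  forall t x y : R, 0 <= t -> t <= 1 -> A x -> A y ->
    t * f x + (1 - t) * f y <= f (t * x + (1 - t) * y).

(* Main.v *)
(** Write [a_n] for the weight of the edge [{n, n+1}], with [a_(-1) = 0]. On a
physical linear graph [Gamma2 h n] is a quadratic form in the increments
[h (k+1) - h k] for [n-2 <= k <= n+1], and completing squares writes it as a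
combination of squares whose coefficients are nonnegative as soon as
[a_(k-1) + a_(k+1) <= 2 a_k] for all [k]. For [a_n = f (n + 1)] this is midpoint
concavity of [f]; at [k = 0] the missing weight [a_(-1) = 0] lies below [f 0],
so that [N = 1] works. *)

Require Import Defs.
From HB Require Import structures.
From mathcomp Require Import all_boot all_order all_algebra.
From mathcomp Require Import all_classical all_reals all_analysis.
From mathcomp Require Import ring lra.

Set Implicit Arguments.
Unset Strict Implicit.
Unset Printing Implicit Defensive.

Import Order.TTheory GRing.Theory Num.Theory.
Import numFieldNormedType.Exports.

Local Open Scope classical_set_scope.
Local Open Scope ring_scope.

Definition nat_adj : rel nat := fun m n => (n == m.+1) || (m == n.+1).

Lemma nat_adj_sym : symmetric nat_adj.
Proof. by move=> m n; rewrite /nat_adj orbC. Qed.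

Lemma nat_adj_irrefl : irreflexive nat_adj.
Proof. by move=> n; rewrite /nat_adj orbb ltn_eqF. Qed.

(** The path descends from [x] to 0 and then climbs to [y], which avoids comparing [x] with [y]. *)
Lemma nat_adj_connected x y :
  exists2 p : seq nat, path nat_adj x p & last x p = y.
Proof.
elim: y => [|y [p xp py]].
  elim: x => [|x [p xp p0]]; first by exists [::].
  by exists (x :: p) => //=; rewrite xp andbT /nat_adj eqxx orbT.
exists (rcons p y.+1); last by rewrite last_rcons.
by rewrite rcons_path xp py /nat_adj eqxx.
Qed.

Lemma nat_adj_locally_finite x : finite_set [set y | nat_adj x y].
Proof.
apply: (@sub_finite_set _ _ `I_x.+2); last exact: finite_II.
by move=> y /= /orP[] /eqP -> //; rewrite ltnW.
Qed.

Section NatGraph.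
Variables (R : realType) (a : nat -> R) (a_gt0 : forall n, 0 < a n).

Definition nat_weight (m n : nat) : R :=
  if n == m.+1 then a m else if m == n.+1 then a n else 0.

Lemma nat_weight_sym m n : nat_weight m n = nat_weight n m.
Proof.
rewrite /nat_weight; case: (eqVneq n m.+1) => [->|//].
by rewrite ltn_eqF.
Qed.

Lemma nat_weight_gt0 m n : nat_adj m n -> 0 < nat_weight m n.
Proof. by rewrite /nat_adj /nat_weight; case: eqP => //= _ ->. Qed.

Lemma nat_weight_eq0 m n : ~~ nat_adj m n -> nat_weight m n = 0.
Proof. by rewrite /nat_weight negb_or => /andP[/negPf-> /negPf->]. Qed.

Definition nat_graph : weighted_graph R nat :=
  WeightedGraph nat_adj_sym nat_adj_irrefl nat_adj_connected
    nat_adj_locally_finite nat_weight_sym nat_weight_gt0 nat_weight_eq0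
    (fun=> ltr01).

End NatGraph.

Section LinearGraph.
Variables (R : realType) (G : weighted_graph R nat).
Hypotheses (G_linear : linear_graph G) (G_physical : physical G).
Implicit Types (f g : nat -> R) (n : nat).

(* At n = 0 the predecessor n.-1 is 0 itself and contributes nothing. *)
Lemma laplacian_linear f n :
  laplacian G f n = weight G n n.+1 * (f n.+1 - f n)
                    + weight G n n.-1 * (f n.-1 - f n).
Proof.
rewrite /laplacian G_physical invr1 mul1r.
case: n => [|n] /=.
  rewrite subrr mulr0 addr0.
  rewrite (_ : [set y | adj G 0 y] = [set 1%N]) ?fsbig_set1 //.
  by apply/seteqP; split=> y /=; rewrite G_linear orbF => /eqP.
rewrite (_ : [set y | adj G n.+1 y] = [set n.+2] `|` [set n]); last first.
  apply/seteqP; split=> y /=; rewrite G_linear eqSS.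
    by case/orP=> /eqP->; [left | right].
  by case=> ->; rewrite eqxx ?orbT.
rewrite fsbigU0 ?fsbig_set1 //= => y [-> /eqP].
by rewrite gtn_eqF.
Qed.

(** On each edge the product rule leaves exactly the product of the two increments, so [Gamma2]
    becomes a quadratic form in increments. *)
Lemma Gamma_linear f g n :
  Gamma G f g n =
    2^-1 * (weight G n n.+1 * ((f n.+1 - f n) * (g n.+1 - g n))
            + weight G n n.-1 * ((f n.-1 - f n) * (g n.-1 - g n))).
Proof. by rewrite /Gamma !laplacian_linear; ring. Qed.

Lemma linear_CD0 :
  (forall n, weight G n n.-1 + weight G n.+1 n.+2 <= 2 * weight G n n.+1) ->
  CD G 0 +oo%E.
Proof.
move=> G_concave n f.
have w_ge0 x y : 0 <= weight G x y.
  have [xy|xy] := boolP (adj G x y); last by rewrite weight_eq0.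
  exact: ltW (weight_gt0 xy).
rewrite invey /= !mul0r addr0 /Gamma2 laplacian_linear !Gamma_linear.
rewrite !laplacian_linear.
case: n => [|n] /=.
  (* At the vertex 0 the predecessor weight is that of a loop, hence 0, and the hypothesis reads
     [c <= 2 * a]. *)
  have := G_concave 0%N; rewrite /= weight_eq0 ?G_linear // add0r.
  rewrite (weight_sym G 1 0).
  move: (w_ge0 0 1)%N (w_ge0 1 2)%N.
  set a := weight G 0 1; set c := weight G 1 2 => a0 c0 ca.
  set p := f 1%N - f 0%N.
  rewrite [leRHS](_ : _ = 4^-1 *
    (a * c * (f 2 - f 1 - p) ^+ 2 + a * (2 * a - c) * p ^+ 2
     + 2 * (a * p) ^+ 2)); last by rewrite /p; field.
  by rewrite !(subr_ge0, sqr_ge0, addr_ge0, mulr_ge0).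
(* The vertex is [n.+1]. For [n = 0] the weight [e] below is again that of the absent loop at 0, so
   vertex 1 needs no separate case. *)
have := G_concave n.+1; have := G_concave n => /=.
rewrite (weight_sym G n.+1 n) (weight_sym G n.+2 n.+1).
move: (w_ge0 n n.-1) (w_ge0 n n.+1) (w_ge0 n.+1 n.+2) (w_ge0 n.+2 n.+3).
set e := weight G n n.-1; set b := weight G n n.+1.
set a := weight G n.+1 n.+2; set c := weight G n.+2 n.+3.
move=> e0 b0 a0 c0 eab bca.
set p := f n.+2 - f n.+1; set q := f n.+1 - f n.
(* The outer increments are completed to squares against [p] and [q]. What remains splits into one
   term for each concavity hypothesis and twice the square of [a * p - b * q], the Laplacian of [f]
   at [n.+1]. *)
rewrite [leRHS](_ : _ = 4^-1 *
  (a * c * (f n.+3 - f n.+2 - p) ^+ 2 + b * e * (f n - f n.-1 - q) ^+ 2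
   + a * (2 * a - (b + c)) * p ^+ 2 + b * (2 * b - (e + a)) * q ^+ 2
   + 2 * (a * p - b * q) ^+ 2)); last by rewrite /p /q; field.
by rewrite !(subr_ge0, sqr_ge0, addr_ge0, mulr_ge0).
Qed.

End LinearGraph.

Theorem theorem1p4 (R : realType) (f : R -> R)
    (f_pos : forall x : R, 0 <= x -> 0 < f x)
    (f_concave : concave_function [set x : R | 0 <= x] f) :
  exists N : nat, (1 <= N)%N /\
    exists G : weighted_graph R nat,
      [/\ linear_graph G, physical G, CD G 0 +oo%E &
          forall n : nat, weight G n n.+1 = f (n + N)%:R].
Proof.
have a_gt0 n : 0 < f (n + 1)%:R by exact: f_pos.
(* Without the shift, the condition at 0 would be [f 1 <= 2 * f 0], which fails for
   [f x = 1 + 2 * x]. *)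
exists 1%N; split=> //; exists (nat_graph a_gt0).
have weightS n : nat_weight (fun k => f (k + 1)%:R) n n.+1 = f (n + 1)%:R.
  by rewrite /nat_weight eqxx.
split=> //; apply: linear_CD0 => // n; rewrite /= !weightS.
(* Equality holds for positive [n]; at 0 the left side is 0. *)
have weight_pred : nat_weight (fun k => f (k + 1)%:R) n n.-1 <= f n%:R.
  case: n => [|n]; first by rewrite nat_weight_eq0 // ltW ?f_pos.
  by rewrite /= nat_weight_sym weightS addn1.
have half_ge0 : 0 <= 2^-1 :> R by lra.
have half_le1 : 2^-1 <= 1 :> R by lra.
have := f_concave 2^-1 n%:R n.+2%:R half_ge0 half_le1 (ler0n _ _) (ler0n _ _).
rewrite (_ : 2^-1 * n%:R + _ = (n + 1)%:R); last first.
  by rewrite addn1 -(addn2 n) -(addn1 n) !natrD; field.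
by rewrite addn1 addn1; lra.
Qed.
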